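(* Let $F$ be a field and let $F\langle X\rangle$ be the free associative unital $F$-algebra on the countably infinite set $X=\{x_1,x_2,\dots\}$ of free non-commuting generators. Let $k,l\ge 1$, let $V_1,\dots,V_k$ and $V'_1,\dots,V'_l$ be $T$-ideals of $F\langle X\rangle$, and put $V=V_1\cdots V_k$ and $V'=V'_1\cdots V'_l$. Then $V'\subseteq V$ if and only if there exist a $T$-ideal $I$ of $F\langle X\rangle$ and $T$-ideals $I_1,\dots,I_k,I'_1,\dots,I'_l$ of $F\langle X\rangle$ such that $$I=I_1\cdots I_k=I'_1\cdots I'_l,$$ $$I_1\subseteq V_1,\ \dots,\ I_k\subseteq V_k\quad\text{and}\quad V'_1\subseteq I'_1,\ \dots,\ V'_l\subseteq I'_l.$$
   Context: Algebras are associative with $1$, and algebra endomorphisms are unital. A (two-sided) ideal $I$ of $F\langle X\rangle$ is called a $T$-ideal if $\mu(I)\subseteq I$ for every $F$-algebra endomorphism $\mu$ of $F\langle X\rangle$ (the zero ideal and the whole algebra are $T$-ideals). The product $IJ$ of ideals $I$ and $J$ is the set of all finite sums $\sum a_ib_i$ with $a_i\in I$, $b_i\in J$. *)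

(* Defs.v *)
From mathcomp Require Import all_boot all_algebra.
From mathcomp Require Import boolp classical_sets.
From mathcomp Require Import monalg.

Set Implicit Arguments.
Unset Strict Implicit.
Unset Printing Implicit Defensive.

Import GRing.Theory.
Local Open Scope classical_set_scope.
Local Open Scope ring_scope.

(* F<X>: the monoid algebra over F of the free monoid of words on nat, the
   generator x_(i+1) being the one-letter word i. *)
Notation freeAlg F := {malg F[{fmonom nat}]}.

Section Ideals.
Variable A : pzRingType.
Implicit Types I J : set A.

(* Closure under opposite follows from absorption of - 1. *)
Definition two_sided_ideal I : Prop :=
  [/\ I 0,
      forall x y, I x -> I y -> I (x + y),
      forall a x, I x -> I (a * x)
    & forall a x, I x -> I (x * a)].

Definition ideal_mul I J : set A :=
  [set x | exists2 s : seq (A * A),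
     forall p, p \in s -> I p.1 /\ J p.2
     & x = \sum_(p <- s) p.1 * p.2].

(* I_0 (I_1 (... I_(n-1))). The empty product is the whole ring, which is a
   unit for the product of ideals (ideal_mulT). *)
Definition ideal_prod n (I_ : 'I_n -> set A) : set A :=
  \big[ideal_mul/[set: A]]_(i < n) I_ i.

Lemma ideal_mulT I : two_sided_ideal I -> ideal_mul I setT = I.
Proof.
move=> [I0 ID _ Ir]; apply/seteqP; split=> x /=.
  move=> [s sI ->]; rewrite big_seq; elim/big_ind: _ => // p /sI[Ip _].
  exact: Ir.
move=> Ix; exists [:: (x, 1)] => [p|]; last by rewrite big_seq1 mulr1.
by rewrite inE => /eqP->.
Qed.

Lemma ideal_prod1 (I_ : 'I_1 -> set A) :
  two_sided_ideal (I_ ord0) -> ideal_prod I_ = I_ ord0.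
Proof. by move=> hI; rewrite /ideal_prod big_ord_recl big_ord0 ideal_mulT. Qed.

Lemma ideal_prodS n (I_ : 'I_n.+1 -> set A) :
  ideal_prod I_ = ideal_mul (I_ ord0) (ideal_prod (fun i => I_ (lift ord0 i))).
Proof. exact: big_ord_recl. Qed.

End Ideals.

Definition T_ideal (F : fieldType) (I : set (freeAlg F)) : Prop :=
  two_sided_ideal I /\
  forall mu : {lrmorphism freeAlg F -> freeAlg F}, mu @` I `<=` I.

(* Main.v *)
(* Let V be a two-sided ideal of R = F<X> and p a linear projection of R with
   kernel V. Splitting words at each occurrence of a letter gives
     p(1) f - p(f) = sum_(i, w) (w x_i - p(w x_i)) D_(i,w)(f),
   where D_(i,w)(f) is the sum of (coefficient of w in p(u)) v over the
   occurrences u x_i v in f. The D_(i,w) are right linear on V, so V is a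
   projective right module, and P Q <= V W with P <= V forces P <= V (W : Q).
   Reversing words gives the mirror image when Q <= W.

   For T-ideals, P Q <= V W implies P <= V or Q <= W: take f in P \ V and g in
   Q, with disjoint sets of variables. Apply to f g the operator D_(i,w), for x_i
   a variable of g, with p(u) replaced by p(u') where u' is u with all variables
   of g sent to 0: this shows that, in g = g(0) + sum_i x_i g_i, the g_i are in
   W, and g(0) = 0 because f g(0) is in V.

   Hence V'_1 (V'_2 ... V'_l) <= V_1 (V_2 ... V_k) yields a T-ideal A with
   either V'_1 <= V_1 A and A V'_2 ... V'_l <= V_2 ... V_k, or V'_1 A <= V_1 and
   V'_2 ... V'_l <= A V_2 ... V_k, and one concludes by induction on k + l. *)

Require Import Defs.
From HB Require Import structures.
From mathcomp Require Import all_boot all_algebra.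
From mathcomp Require Import finmap.
From mathcomp Require Import boolp classical_sets.
From mathcomp Require Import monalg.

Local Open Scope classical_set_scope.
Local Open Scope ring_scope.

Import GRing.Theory.

(** * Products and colons of two-sided ideals *)

Section IdealProducts.
Context {A : pzRingType}.
Implicit Types I J K L : set A.

Lemma ideal_mulP I J a b : I a -> J b -> ideal_mul I J (a * b).
Proof.
by move=> Ia Jb; exists [:: (a, b)] => [p|]; rewrite ?big_seq1 // inE => /eqP->.
Qed.

Lemma ideal_mul_sub I J K : K 0 -> (forall x y, K x -> K y -> K (x + y)) ->
  (forall a b, I a -> J b -> K (a * b)) -> ideal_mul I J `<=` K.
Proof.
move=> K0 KD IJK _ [s sIJ ->]; rewrite big_seq.
by elim/big_ind: _ => // p /sIJ[]; exact: IJK.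
Qed.

Lemma ideal_mul0 I J : ideal_mul I J 0.
Proof. by exists [::] => //; rewrite big_nil. Qed.

Lemma ideal_mulD I J x y :
  ideal_mul I J x -> ideal_mul I J y -> ideal_mul I J (x + y).
Proof.
move=> [s sIJ ->] [t tIJ ->]; exists (s ++ t); last by rewrite big_cat.
by move=> p; rewrite mem_cat => /orP[/sIJ|/tIJ].
Qed.

Lemma ideal_mul_subset I J K L :
  I `<=` K -> J `<=` L -> ideal_mul I J `<=` ideal_mul K L.
Proof. by move=> IK JL x [s sIJ ->]; exists s => // p /sIJ[/IK ? /JL ?]. Qed.

Lemma ideal_mulA I J K :
  ideal_mul (ideal_mul I J) K = ideal_mul I (ideal_mul J K).
Proof.
apply/seteqP; split; apply: ideal_mul_sub.
- exact: ideal_mul0.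
- exact: ideal_mulD.
- move=> x c IJx Kc.
  suff: [set x | ideal_mul I (ideal_mul J K) (x * c)] x by [].
  apply: ideal_mul_sub IJx => /=.
  + by rewrite mul0r; exact: ideal_mul0.
  + by move=> y z ? ?; rewrite mulrDl; exact: ideal_mulD.
  + by move=> a b Ia Jb; rewrite -mulrA; do 2?apply: ideal_mulP.
- exact: ideal_mul0.
- exact: ideal_mulD.
- move=> a x Ia JKx.
  suff: [set x | ideal_mul (ideal_mul I J) K (a * x)] x by [].
  apply: ideal_mul_sub JKx => /=.
  + by rewrite mulr0; exact: ideal_mul0.
  + by move=> y z ? ?; rewrite mulrDr; exact: ideal_mulD.
  + by move=> b c Jb Kc; rewrite mulrA; do 2?apply: ideal_mulP.
Qed.

Lemma two_sided_ideal_mul I J :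
  two_sided_ideal I -> two_sided_ideal J -> two_sided_ideal (ideal_mul I J).
Proof.
move=> [_ _ Il _] [_ _ _ Jr]; split.
- exact: ideal_mul0.
- exact: ideal_mulD.
- move=> a x [s sIJ ->]; exists [seq (a * p.1, p.2) | p <- s].
    by move=> _ /mapP[p /sIJ[Ip Jp] ->]; split=> //; exact: Il.
  by rewrite big_map mulr_sumr; apply: eq_bigr => p _; rewrite mulrA.
- move=> a x [s sIJ ->]; exists [seq (p.1, p.2 * a) | p <- s].
    by move=> _ /mapP[p /sIJ[Ip Jp] ->]; split=> //; exact: Jr.
  by rewrite big_map mulr_suml; apply: eq_bigr => p _; rewrite mulrA.
Qed.

Lemma ideal_mul_subl I J : two_sided_ideal I -> ideal_mul I J `<=` I.
Proof. by move=> [I0 ID _ Ir]; apply: ideal_mul_sub => // a b /Ir. Qed.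

Lemma ideal_mul_subr I J : two_sided_ideal J -> ideal_mul I J `<=` J.
Proof. by move=> [J0 JD Jl _]; apply: ideal_mul_sub => // a b _ /Jl. Qed.

(** The colon $(J : K)$ for multiplication by $K$ on the right; [ideal_colonr] is its mirror
    image. *)
Definition ideal_colon J K : set A := [set a | forall b, K b -> J (a * b)].

Lemma two_sided_ideal_colon J K : two_sided_ideal J -> two_sided_ideal K ->
  two_sided_ideal (ideal_colon J K).
Proof.
move=> [J0 JD Jl _] [_ _ Kl _]; split.
- by move=> b _; rewrite mul0r.
- by move=> x y Jx Jy b Kb; rewrite mulrDl; apply: JD; [exact: Jx|exact: Jy].
- by move=> a x Jx b Kb; rewrite -mulrA; apply/Jl/Jx.
- by move=> a x Jx b Kb; rewrite -mulrA; apply/Jx/Kl.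
Qed.

Lemma ideal_mul_colon J K : two_sided_ideal J ->
  ideal_mul (ideal_colon J K) K `<=` J.
Proof. by move=> [J0 JD _ _]; apply: ideal_mul_sub => // a b; exact. Qed.

Lemma ideal_sum I n (P : pred n) (s : seq n) (f : n -> A) :
  two_sided_ideal I -> (forall i, P i -> I (f i)) ->
  I (\sum_(i <- s | P i) f i).
Proof. by move=> [I0 ID _ _] If; elim/big_ind: _. Qed.

Lemma ideal_prod_subset n (I_ J_ : 'I_n -> set A) :
  (forall i, I_ i `<=` J_ i) -> ideal_prod I_ `<=` ideal_prod J_.
Proof.
elim: n I_ J_ => [|n IHn] I_ J_ IJ; first by rewrite /ideal_prod !big_ord0.
rewrite !ideal_prodS; apply: ideal_mul_subset; first exact: IJ.
by apply: IHn => i; exact: IJ.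
Qed.

(** Puts a new first factor in front of a product, for the induction in [T_closed_refinement]. *)
Definition ideal_cons n I (I_ : 'I_n -> set A) (i : 'I_n.+1) : set A :=
  if unlift ord0 i is Some j then I_ j else I.

Lemma ideal_cons0 n I (I_ : 'I_n -> set A) : ideal_cons n I I_ ord0 = I.
Proof. by rewrite /ideal_cons unlift_none. Qed.

Lemma ideal_consS n I (I_ : 'I_n -> set A) j :
  ideal_cons n I I_ (lift ord0 j) = I_ j.
Proof. by rewrite /ideal_cons liftK. Qed.

Lemma ideal_prod_cons n I (I_ : 'I_n -> set A) :
  ideal_prod (ideal_cons n I I_) = ideal_mul I (ideal_prod I_).
Proof.
rewrite ideal_prodS ideal_cons0; congr (ideal_mul _ (ideal_prod _)).
by apply: funext => j; exact: ideal_consS.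
Qed.

End IdealProducts.

(** Zorn's lemma gives a maximal subspace $C$ with $C \cap W = 0$. It is a complement of $W$, and
    $p$ is the projection onto $C$ along $W$. *)
Lemma linear_projection (F : fieldType) (M : lmodType F) (W : set M) :
  W 0 -> (forall c x y, W x -> W y -> W (c *: x + y)) ->
  exists p : {linear M -> M}, (forall w, W w -> p w = 0) /\
    forall x, W (x - p x).
Proof.
move=> W0 Wlin.
pose subsp (C : set M) := C 0 /\ forall c x y, C x -> C y -> C (c *: x + y).
pose indep (C : set M) := forall x, C x -> W x -> x = 0.
have WN x : W x -> W (- x).
  by move=> Wx; rewrite -scaleN1r -[_ *: _]addr0; exact: Wlin.
have WD x y : W x -> W y -> W (x + y).
  by move=> Wx; rewrite -[x]scale1r; exact: Wlin.
(* The first alternative covers the union of an empty chain, which is empty and hence not a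
   subspace. *)
pose good (C : set M) := C `<=` set0 \/ subsp C /\ indep C.
have [|C [goodC maxC]] := @Zorn_bigcup _ good.
  move=> Fam FamP tot.
  have [[C [FC [x Cx]]]|noC] := pselect (exists C, Fam C /\ C !=set0);
    last first.
    by left=> x [C FC Cx]; apply: noC; exists C; split=> //; exists x.
  right; split; last first.
    by move=> y [D FD Dy] Wy; have [/(_ _ Dy)//|[_]] := FamP _ FD; apply.
  split.
    have [/(_ _ Cx)//|[[C0 _] _]] := FamP _ FC; by exists C.
  move=> c y z [D FD Dy] [E FE Ez].
  have [DE|ED] := tot _ _ FD FE.
    have [/(_ _ Ez)//|[[_ Elin] _]] := FamP _ FE.
    by exists E => //; apply: Elin => //; exact: DE.
  have [/(_ _ Dy)//|[[_ Dlin] _]] := FamP _ FD.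
  by exists D => //; apply: Dlin => //; exact: ED.
have {goodC} [[C0 Clin] Cind] : subsp C /\ indep C.
  case: goodC => // C0; exfalso; apply: (maxC [set 0]).
    by split=> [x /C0//|/(_ 0 erefl)/C0].
  right; split; last by move=> x ->.
  by split=> // c x y -> ->; rewrite scaler0 addr0.
(* If $x \notin C + W$, then $Fx + C$ is strictly larger than $C$ and still meets $W$ only in 0,
   against maximality. *)
have decomp x : exists y, C y /\ W (x - y).
  apply: contrapT => noy.
  pose D := [set z | exists c y, C y /\ z = c *: x + y].
  have CD : C `<=` D by move=> y Cy; exists 0, y; rewrite scale0r add0r.
  apply: (maxC D).
    split=> // DC; apply: noy; exists x; rewrite subrr; split=> //.
    by apply: DC; exists 1, 0; rewrite scale1r addr0.
  right; split; first split; first exact: CD.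
    move=> c _ _ [a [y [Cy ->]]] [b [z [Cz ->]]].
    exists (c * a + b), (c *: y + z); split; first exact: Clin.
    by rewrite scalerDr scalerDl scalerA addrACA.
  move=> _ [c [y [Cy ->]]] Wxy.
  have [c0|cN0] := eqVneq c 0.
    by move: Wxy; rewrite c0 scale0r add0r; exact: Cind.
  exfalso; apply: noy; exists (- c^-1 *: y); split.
    by rewrite -[_ *: _]addr0; exact: Clin.
  have -> : x - - c^-1 *: y = c^-1 *: (c *: x + y) + 0.
    by rewrite scaleNr opprK scalerDr scalerA mulVf // scale1r addr0.
  exact: Wlin.
have /choice[p pP] := decomp.
have uniq x y z : C y -> W (x - y) -> C z -> W (x - z) -> y = z.
  move=> Cy Wy Cz Wz; apply/eqP; rewrite -subr_eq0; apply/eqP; apply: Cind.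
    by rewrite addrC -scaleN1r; exact: Clin.
  have -> : y - z = (x - z) + - (x - y) by rewrite opprB [RHS]addrC addrA subrK.
  by apply: WD => //; exact: WN.
have plin : linear p.
  move=> c x y; have [Cx Wx] := pP x; have [Cy Wy] := pP y.
  have [Cz Wz] := pP (c *: x + y); apply: (uniq _ _ _ Cz Wz).
    exact: Clin.
  by rewrite opprD addrACA -scalerBr; exact: Wlin.
exists (HB.pack_for {linear M -> M} p
  (GRing.isLinear.Build _ _ _ _ p plin)); split=> [w Ww|x] /=.
  by have [Cw Www] := pP w; apply: (uniq w) => //; rewrite subr0.
by case: (pP x).
Qed.

(* The free algebra is manipulated through its basis of words: the concrete
   multiplication of [{malg F[{fmonom nat}]}] is very slow to unify. *)
Record word_basis (F : fieldType) (R : lalgType F) := WordBasis {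
  word : seq nat -> R;
  linext : forall M : lmodType F, (seq nat -> M) -> {linear R -> M};
  word_nil : word [::] = 1;
  word_cat : forall w w', word (w ++ w') = word w * word w';
  linext_word : forall M b w, linext M b (word w) = b w;
  word_ind : forall P : R -> Prop, (forall w, P (word w)) ->
    (forall c f g, P f -> P g -> P (c *: f + g)) -> forall f, P f;
  scaler_mulr : forall c (f g : R), c *: (f * g) = f * (c *: g)
}.

(** * Substitutions, reversal of words, and the operators [der] that split words at a letter *)

Section FreeAlgebra.
Context {F : fieldType} {R : lalgType F} (B : word_basis F R).
Implicit Types (f g h : R) (w : seq nat).

Local Notation word := (word _ _ B).
Local Notation linext := (linext _ _ B _).
Local Notation word_nil := (word_nil _ _ B).
Local Notation word_cat := (word_cat _ _ B).
Local Notation linext_word := (linext_word _ _ B _).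
Local Notation word_ind := (word_ind _ _ B).
Local Notation scaler_mulr := (scaler_mulr _ _ B).

Definition gen i : R := word [:: i].

Lemma word_cons i w : word (i :: w) = gen i * word w.
Proof. exact: (word_cat [:: i]). Qed.

Lemma gen_ind (P : R -> Prop) :
  P 1 -> (forall i f, P f -> P (gen i * f)) ->
  (forall c f g, P f -> P g -> P (c *: f + g)) -> forall f, P f.
Proof.
move=> P1 PM; apply: word_ind; elim=> [|i w IHw]; first by rewrite word_nil.
by rewrite word_cons; exact: PM.
Qed.

Lemma linext1 (M : lmodType F) (b : seq nat -> M) : linext b 1 = b [::].
Proof. by rewrite -word_nil linext_word. Qed.

Definition subst (s : nat -> R) : {linear R -> R} :=
  linext (fun w => \prod_(i <- w) s i).

Lemma subst1 s : subst s 1 = 1.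
Proof. by rewrite /subst linext1 big_nil. Qed.

Lemma subst_gen_mul s i f : subst s (gen i * f) = s i * subst s f.
Proof.
elim/word_ind: f => [w|c f g IHf IHg].
  by rewrite -word_cons /subst !linext_word big_cons.
by rewrite mulrDr -scaler_mulr !linearP {}IHf {}IHg mulrDr -scaler_mulr.
Qed.

Lemma subst_gen s i : subst s (gen i) = s i.
Proof. by rewrite -[gen i]mulr1 subst_gen_mul subst1 mulr1. Qed.

Lemma substM s : {morph subst s : f g / f * g}.
Proof.
move=> f g; elim/gen_ind: f => [|i f IHf|c f h IHf IHh].
- by rewrite subst1 !mul1r.
- by rewrite -mulrA !subst_gen_mul {}IHf mulrA.
- by rewrite mulrDl -scalerAl !linearP {}IHf {}IHh mulrDl -scalerAl.
Qed.

Lemma subst_comp s s' f : subst s (subst s' f) = subst (subst s \o s') f.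
Proof.
elim/gen_ind: f => [|i f IHf|c f g IHf IHg]; first by rewrite !subst1.
  by rewrite !subst_gen_mul substM {}IHf.
by rewrite !linearP {}IHf {}IHg.
Qed.

Lemma subst_id f : subst gen f = f.
Proof.
elim/gen_ind: f => [|i f IHf|c f g IHf IHg]; first by rewrite subst1.
  by rewrite subst_gen_mul {}IHf.
by rewrite linearP {}IHf {}IHg.
Qed.

(** An endomorphism is determined by its values on the generators, so $T$-ideals can be tested on
    substitutions alone. *)
Lemma lrmorph_subst (mu : {lrmorphism R -> R}) f : mu f = subst (mu \o gen) f.
Proof.
elim/gen_ind: f => [|i f IHf|c f g IHf IHg]; first by rewrite subst1 rmorph1.
  by rewrite subst_gen_mul rmorphM /= {}IHf.
by rewrite !linearP /= {}IHf {}IHg.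
Qed.

Definition T_closed (I : set R) :=
  two_sided_ideal I /\ forall s f, I f -> I (subst s f).

Lemma T_closedP (I : set R) :
  (two_sided_ideal I /\ forall mu : {lrmorphism R -> R}, mu @` I `<=` I) <->
  T_closed I.
Proof.
split=> [] [idI TI]; split=> //.
  move=> s f If; pose mu := HB.pack_for {lrmorphism R -> R} (subst s : R -> R)
    (GRing.isMonoidMorphism.Build R R (subst s) (conj (subst1 s) (substM s)))
    (GRing.isLinear.Build F R R _ (subst s) (linearP (subst s))).
  by apply: (TI mu); exists f.
by move=> mu _ [f If <-]; rewrite lrmorph_subst; exact: TI.
Qed.

Definition reversal : {linear R -> R} := linext (word \o rev).

Lemma reversal_word w : reversal (word w) = word (rev w).
Proof. exact: linext_word. Qed.

Lemma reversalM f g : reversal (f * g) = reversal g * reversal f.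
Proof.
elim/word_ind: f => [w|c f h IHf IHh]; last first.
  by rewrite mulrDl -scalerAl !linearP {}IHf {}IHh mulrDr -scaler_mulr.
elim/word_ind: g => [w'|c f g IHf IHg].
  by rewrite -word_cat !reversal_word -word_cat rev_cat.
by rewrite mulrDr -scaler_mulr !linearP {}IHf {}IHg mulrDl -scalerAl.
Qed.

Lemma reversalK : involutive reversal.
Proof.
elim/word_ind=> [w|c f g IHf IHg]; first by rewrite !reversal_word revK.
by rewrite !linearP {}IHf {}IHg.
Qed.

(* [der i psi f] is the sum of psi(u) v over the occurrences u x_i v in f. *)
Fixpoint der_word i (psi : R -> F) w : R :=
  if w is j :: w' then
    (if j == i then psi 1 *: word w' else 0)
      + der_word i (fun u => psi (gen j * u)) w'
  else 0.

Definition der i (psi : R -> F) : {linear R -> R} := linext (der_word i psi).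

Lemma der1 i psi : der i psi 1 = 0.
Proof. exact: linext1. Qed.

Lemma der_gen_mul i psi j f : der i psi (gen j * f) =
  (if j == i then psi 1 *: f else 0) + der i (fun u => psi (gen j * u)) f.
Proof.
elim/word_ind: f => [w|c f g IHf IHg].
  by rewrite -word_cons /der !linext_word.
rewrite mulrDr -scaler_mulr !linearP {}IHf {}IHg.
case: eqP => _; last by rewrite !add0r.
by rewrite !scalerDr !scalerA [c * _]mulrC addrACA.
Qed.

Lemma der_functional i c psi psi' f :
  der i (fun u => c * psi u + psi' u) f = c *: der i psi f + der i psi' f.
Proof.
elim/gen_ind: f psi psi' => [|j f IHf|a f g IHf IHg] psi psi'.
- by rewrite !der1 scaler0 addr0.
- rewrite !der_gen_mul IHf; case: eqP => _; last by rewrite !add0r.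
  by rewrite scalerDl scalerDr scalerA addrACA.
- rewrite !linearP {}IHf {}IHg !scalerDr !scalerA addrACA.
  by rewrite [a * c]mulrC addrACA.
Qed.

Lemma der_zero i f : der i (fun=> 0) f = 0.
Proof.
have := der_functional i (-1) (fun=> 0) (fun=> 0) f.
by rewrite mulr0 addr0 scaleN1r addNr.
Qed.

Lemma der_scale i c psi f : der i (fun u => c * psi u) f = c *: der i psi f.
Proof.
have := der_functional i c psi (fun=> 0) f; rewrite der_zero addr0 => <-.
by congr (der _ _ _); apply: funext => u; rewrite addr0.
Qed.

(** An occurrence of $x_i$ in a product lies in the left factor, or in the right one, where its
    prefix $u$ becomes $f u$. *)
Lemma derM i psi f g : (forall c x y, psi (c *: x + y) = c * psi x + psi y) ->
  der i psi (f * g) = der i psi f * g + der i (fun u => psi (f * u)) g.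
Proof.
elim/gen_ind: f psi => [|j f IHf|a f h IHf IHh] psi psiL.
- rewrite der1 mul0r mul1r add0r; congr (der _ _ _).
  by apply: funext => u; rewrite mul1r.
- rewrite -mulrA !der_gen_mul IHf => [|c x y].
    rewrite mulrDl addrA; congr (_ + _ + _).
      by case: eqP => _; rewrite ?scalerAl ?mul0r.
    by congr (der _ _ _); apply: funext => u; rewrite mulrA.
  by rewrite mulrDr -scaler_mulr psiL.
- rewrite mulrDl -scalerAl !linearP IHf // IHh //.
  rewrite mulrDl -scalerAl scalerDr addrACA; congr (_ + _).
  rewrite -der_functional; congr (der _ _ _); apply: funext => u.
  by rewrite mulrDl -scalerAl psiL.
Qed.

(** Any $N$ above all letters occurring in $f$ works. These two properties stand in for the set of
    variables of $f$. *)
Lemma finite_support f : exists N,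
  (forall s s', (forall i, (i < N)%N -> s i = s' i) ->
    subst s f = subst s' f) /\
  (forall i psi, (N <= i)%N -> der i psi f = 0).
Proof.
elim/gen_ind: f => [|j f [N [substN derN]]|c f g [N [sN dN]] [N' [sN' dN']]].
- by exists 0%N; split=> *; rewrite ?subst1 ?der1.
- exists (maxn N j.+1); split=> [s s' ss'|i psi].
    rewrite !subst_gen_mul ss' ?leq_maxr //; congr (_ * _).
    by apply: substN => i iN; rewrite ss' // (leq_trans iN) ?leq_maxl.
  rewrite geq_max => /andP[Ni ji]; rewrite der_gen_mul derN //.
  by rewrite ltn_eqF // addr0.
- exists (maxn N N'); split=> [s s' ss'|i psi].
    rewrite !linearP; congr (_ *: _ + _).
      by apply: sN => i iN; rewrite ss' // (leq_trans iN) ?leq_maxl.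
    by apply: sN' => i iN; rewrite ss' // (leq_trans iN) ?leq_maxr.
  rewrite geq_max => /andP[Ni N'i]; rewrite linearP dN // dN' //.
  by rewrite scaler0 addr0.
Qed.

(** With $N$ from [finite_support f], the elements $f$ and [shift N g] have disjoint sets of
    variables. *)
Definition shift N : {linear R -> R} := subst (fun i => gen (N + i)).

Lemma der_shift N j psi f :
  der (N + j) psi (shift N f) = shift N (der j (psi \o shift N) f).
Proof.
elim/gen_ind: f psi => [|i f IHf|c f g IHf IHg] psi.
- by rewrite /shift subst1 !der1 linear0.
- rewrite /shift subst_gen_mul !der_gen_mul eqn_add2l linearD /= IHf.
  congr (_ + shift _ _).
    by case: eqP => _; rewrite ?linear0 // linearZ /= subst1.
  by congr (der _ _ _); apply: funext => u /=; rewrite /shift subst_gen_mul.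
- by rewrite !linearP {}IHf {}IHg.
Qed.

(** The scalar is the constant term of $f$. *)
Lemma substZ1 f : exists c, subst (fun=> 0) f = c%:A.
Proof.
elim/gen_ind: f => [|i f _|c f g [a fa] [b gb]].
- by exists 1; rewrite subst1 scale1r.
- by exists 0; rewrite subst_gen_mul mul0r scale0r.
- by exists (c * a + b); rewrite linearP fa gb scalerDl scalerA.
Qed.

Lemma subst_shift s N f : subst s (shift N f) = subst (fun i => s (N + i)%N) f.
Proof.
rewrite /shift subst_comp; congr (subst _ _); apply: funext => i.
exact: subst_gen.
Qed.

(** * Coordinates on words and the expansion of $p(u) f - p(u f)$ *)

Definition coord (w : seq nat) : {linear R -> F^o} :=
  linext (fun v => ((v == w)%:R : F^o)).

(** Allowing every $T$ that contains the support lets several elements be expanded over one common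
    $T$. *)
Lemma coord_span f : exists S : seq (seq nat),
  forall T, uniq T -> {subset S <= T} ->
    f = \sum_(w <- T) (coord w f : F) *: word w.
Proof.
elim/word_ind: f => [v|c f g [S fS] [T gT]].
  exists [:: v] => T uT /(_ v); rewrite mem_seq1 eqxx => /(_ isT) vT.
  rewrite (bigD1_seq v) //= big1 => [|w wv].
    by rewrite /coord linext_word eqxx scale1r addr0.
  by rewrite /coord linext_word eq_sym (negPf wv) scale0r.
exists (S ++ T) => U uU STU.
rewrite {1}(fS U) // => [|w wS]; last by rewrite STU // mem_cat wS.
rewrite {1}(gT U) // => [|w wT]; last by rewrite STU // mem_cat wT orbT.
rewrite scaler_sumr -big_split; apply: eq_bigr => w _ /=.
by rewrite linearP scalerDl scalerA.
Qed.

(** The analogue of Schreier generators of a subgroup, with $p$ in the role of the choice of coset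
    representatives. *)
Definition schreier (p : R -> R) i w := word w * gen i - p (word w * gen i).

(** Induction on $f$ strips the first letter and moves it to the end of $u$, hence the general $u$.
    The sums may be taken over any large enough $n$ and $T$, so that expansions can be added. *)
Lemma schreier_expansion (p : {linear R -> R}) :
  (forall u i, p (u * gen i) = p (p u * gen i)) ->
  forall f u, exists N (S : seq (seq nat)), forall n T,
    (N <= n)%N -> uniq T -> {subset S <= T} ->
    p u * f - p (u * f) = \sum_(i < n) \sum_(w <- T)
      schreier p i w * der i (fun y => coord w (p (u * y)) : F) f.
Proof.
move=> pp; elim/gen_ind=> [|j f IHf|c f g IHf IHg] u.
- exists 0%N, [::] => n T _ _ _; rewrite !mulr1 subrr big1 // => i _.
  by rewrite big1 // => w _; rewrite der1 mulr0.
- have [N [S NS]] := IHf (u * gen j); have [S' puS'] := coord_span (p u).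
  exists (maxn N j.+1), (S ++ S') => n T; rewrite geq_max => /andP[Nn jn] uT ST.
  have {}puS' : p u = \sum_(w <- T) (coord w (p u) : F) *: word w.
    by apply: puS' => // w wS'; rewrite ST // mem_cat wS' orbT.
  under eq_bigr do under eq_bigr do rewrite der_gen_mul mulrDr.
  under eq_bigr do rewrite big_split.
  rewrite big_split /=.
  (* Telescoping: the second summand is the induction hypothesis at $u x_j$, the first comes from
     the leading letter. *)
  transitivity ((p u * gen j - p (u * gen j)) * f
    + (p (u * gen j) * f - p (u * gen j * f))).
    by rewrite mulrBl addrA subrK !mulrA.
  congr (_ + _); last first.
    rewrite (NS n T) // => [|w wS]; last by rewrite ST // mem_cat wS.
    apply: eq_bigr => i _; apply: eq_bigr => w _; congr (_ * der _ _ _).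
    by apply: funext => y; rewrite mulrA.
  (* Only $i = j$ contributes. The leading $x_j$ has the empty prefix, so its weight is the
     coordinate of $p(u)$ at $w$. *)
  rewrite (bigD1 (Ordinal jn)) //= [X in _ = _ + X]big1 ?addr0 => [|i ij];
      last first.
    rewrite big1 // => w _; case: eqP => [ji|_]; last by rewrite mulr0.
    by case/eqP: ij; apply: val_inj.
  rewrite eqxx mulr1.
  under eq_bigr do rewrite -scaler_mulr scalerAl.
  rewrite -mulr_suml pp {1 2}puS'; congr (_ * _).
  rewrite mulr_suml linear_sum -sumrB; apply: eq_bigr => w _.
  by rewrite -scalerAl linearZ -scalerBr.
- have [N [S NS]] := IHf u; have [N' [S' NS']] := IHg u.
  exists (maxn N N'), (S ++ S') => n T; rewrite geq_max => /andP[Nn N'n] uT ST.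
  have sS : {subset S <= T} by move=> w wS; rewrite ST // mem_cat wS.
  have sS' : {subset S' <= T} by move=> w wS; rewrite ST // mem_cat wS orbT.
  transitivity (c *: (p u * f - p (u * f)) + (p u * g - p (u * g))).
    rewrite !mulrDr -!scaler_mulr linearP scalerBr opprD.
    by rewrite addrACA.
  rewrite (NS n T) // (NS' n T) // scaler_sumr -big_split /=.
  apply: eq_bigr => i _; rewrite scaler_sumr -big_split /=.
  apply: eq_bigr => w _.
  by rewrite linearP mulrDr scaler_mulr.
Qed.

(** * Factoring an inclusion $P Q \subseteq V W$ of two-sided ideals *)

Section Ideals.
Implicit Types P Q V W I J : set R.

Lemma idealZ I c f : two_sided_ideal I -> I f -> I (c *: f).
Proof. by move=> [_ _ Il _] If; rewrite -mulr_algl; exact: Il. Qed.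

Lemma ideal_projection V : two_sided_ideal V ->
  exists p : {linear R -> R}, (forall f, V f -> p f = 0) /\
    forall f, V (f - p f).
Proof.
move=> idV; have [V0 VD _ _] := idV; apply: linear_projection => // c x y Vx Vy.
by apply: VD => //; exact: idealZ.
Qed.

(** Since $\psi$ vanishes on $f u \in V$ for all $u$, the second term of [derM] disappears: this is
    right linearity on $V$. *)
Lemma der_annihilator V i (psi : R -> F) f g : two_sided_ideal V ->
  (forall c x y, psi (c *: x + y) = c * psi x + psi y) ->
  (forall f, V f -> psi f = 0) -> V f ->
  der i psi (f * g) = der i psi f * g.
Proof.
move=> [_ _ _ Vr] psiL psiV Vf; rewrite derM //.
rewrite (_ : (fun u => psi (f * u)) = fun=> 0) ?der_zero ?addr0 //.
by apply: funext => u; apply/psiV/Vr.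
Qed.

Lemma der_ideal_mul V W i (psi : R -> F) f :
  two_sided_ideal V -> two_sided_ideal W ->
  (forall c x y, psi (c *: x + y) = c * psi x + psi y) ->
  (forall f, V f -> psi f = 0) -> ideal_mul V W f -> W (der i psi f).
Proof.
move=> idV [W0 WD Wl _] psiL psiV.
apply: (ideal_mul_sub V W [set f | W (der i psi f)]) => /=.
- by rewrite linear0.
- by move=> x y Wx Wy; rewrite linearD; exact: WD.
- by move=> a b Va Wb; rewrite (der_annihilator V) //; exact: Wl.
Qed.

(* The right ideal V is projective: every f in V is a combination of the
   elements (1 - p 1) and [schreier p i w] of V, with coefficients which are
   right linear functions of f. *)
Lemma ideal_mul_factorl P Q V W : two_sided_ideal Q ->
  two_sided_ideal V -> two_sided_ideal W ->
  ideal_mul P Q `<=` ideal_mul V W -> P `<=` V ->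
  P `<=` ideal_mul V (ideal_colon W Q).
Proof.
move=> idQ idV idW PQVW PV f Pf; have Vf := PV _ Pf.
have [p [pV Vp]] := ideal_projection _ idV.
have idA := two_sided_ideal_colon _ _ idW idQ.
have idVA := two_sided_ideal_mul _ _ idV idA.
have [_ _ _ Vr] := idV; have [_ VAD _ _] := idVA.
have pp u i : p (u * gen i) = p (p u * gen i).
  apply/eqP; rewrite -subr_eq0 -linearB -mulrBl; apply/eqP/pV.
  exact: (Vr _ _ (Vp u)).
(* As $p(f) = 0$, the expansion at $u = 1$ is one of $p(1) f$; adding $(1 - p(1)) f$ recovers
   $f$. *)
have [N [S /(_ N (undup S) (leqnn N) (undup_uniq S))]] :=
  schreier_expansion _ pp f 1.
rewrite mul1r (pV f) // subr0 => expand.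
have -> : f = (1 - p 1) * f + p 1 * f by rewrite -mulrDl subrK mul1r.
apply: VAD.
  apply: ideal_mulP => // g Qg.
  by apply: (ideal_mul_subr V W idW); apply/PQVW/ideal_mulP.
rewrite expand => [|w]; last by rewrite mem_undup.
apply: ideal_sum => // i _; apply: ideal_sum => // w _.
apply: ideal_mulP => [|g Qg]; first exact: Vp.
have psiV x : V x -> (coord w (p (1 * x)) : F) = 0.
  by move=> Vx; rewrite mul1r pV // linear0.
have psiL c x y : (coord w (p (1 * (c *: x + y))) : F) =
    c * (coord w (p (1 * x)) : F) + (coord w (p (1 * y)) : F).
  by rewrite !mul1r !linearP.
(* The coefficient times $g$ is the operator applied to $f g \in V W$, hence lies in $W$. *)
rewrite -(der_annihilator V) //.
by apply: (der_ideal_mul V) => //; apply/PQVW/ideal_mulP.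
Qed.

Definition ideal_colonr J I : set R := [set b | forall a, I a -> J (a * b)].

Lemma two_sided_ideal_colonr J I : two_sided_ideal J -> two_sided_ideal I ->
  two_sided_ideal (ideal_colonr J I).
Proof.
move=> [J0 JD _ Jr] [_ _ _ Ir]; split.
- by move=> a _; rewrite mulr0.
- by move=> x y Jx Jy a Ia; rewrite mulrDr; apply: JD; [exact: Jx|exact: Jy].
- by move=> b x Jx a Ia; rewrite mulrA; apply/Jx/Ir.
- by move=> b x Jx a Ia; rewrite mulrA; apply/Jr/Jx.
Qed.

Let rev_set I : set R := reversal @^-1` I.

Let rev_set_ideal I : two_sided_ideal I -> two_sided_ideal (rev_set I).
Proof.
rewrite /rev_set => -[I0 ID Il Ir]; split=> /=.
- by rewrite linear0.
- by move=> x y Ix Iy; rewrite linearD; exact: ID.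
- by move=> a x Ix; rewrite reversalM; exact: Ir.
- by move=> a x Ix; rewrite reversalM; exact: Il.
Qed.

Let rev_ideal_mul I J f :
  ideal_mul I J f -> ideal_mul (rev_set J) (rev_set I) (reversal f).
Proof.
move: f; apply: (ideal_mul_sub I J
  [set f | ideal_mul (rev_set J) (rev_set I) (reversal f)]) => /=.
- by rewrite linear0; exact: ideal_mul0.
- by move=> x y; rewrite linearD; exact: ideal_mulD.
- move=> a b Ia Jb; rewrite reversalM.
  by apply: ideal_mulP; rewrite /rev_set /= reversalK.
Qed.

(** Reversal is an involutive anti-automorphism, so [ideal_mul_factorl] applies to the reversed
    ideals with left and right exchanged. *)
Lemma ideal_mul_factorr P Q V W : two_sided_ideal P ->
  two_sided_ideal V -> two_sided_ideal W ->
  ideal_mul P Q `<=` ideal_mul V W -> Q `<=` W ->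
  Q `<=` ideal_mul (ideal_colonr V P) W.
Proof.
move=> idP idV idW PQVW QW f Qf.
have revrev I : rev_set (rev_set I) = I.
  by apply/funext => x; rewrite /rev_set /preimage /= /mkset /= reversalK.
have QPWV : ideal_mul (rev_set Q) (rev_set P) `<=`
    ideal_mul (rev_set W) (rev_set V).
  move=> x /rev_ideal_mul; rewrite !revrev => /PQVW/rev_ideal_mul.
  by rewrite reversalK.
have := ideal_mul_factorl _ _ _ _ (rev_set_ideal _ idP) (rev_set_ideal _ idW)
  (rev_set_ideal _ idV) QPWV.
have rQW : rev_set Q `<=` rev_set W by move=> x /QW.
move=> /(_ rQW (reversal f)); rewrite /rev_set /= reversalK => /(_ Qf).
move=> /rev_ideal_mul; rewrite reversalK; apply: ideal_mul_subset => x.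
  rewrite /rev_set /= => cx a Pa.
  by have := cx (reversal a); rewrite /= reversalK reversalM !reversalK; apply.
by rewrite /rev_set /= reversalK.
Qed.

(** * $T$-ideals and the use of disjoint variables *)

Lemma T_closed_mul I J : T_closed I -> T_closed J -> T_closed (ideal_mul I J).
Proof.
move=> [idI TI] [idJ TJ]; split; first exact: two_sided_ideal_mul.
move=> s; apply: (ideal_mul_sub I J [set f | ideal_mul I J (subst s f)]) => /=.
- by rewrite linear0; exact: ideal_mul0.
- by move=> x y; rewrite linearD; exact: ideal_mulD.
- by move=> a b Ia Jb; rewrite substM; apply: ideal_mulP; [exact: TI|exact: TJ].
Qed.

(** Once the variables are disjoint, one substitution can act as $s$ on $f$ and undo the shift on
    $g$. *)
Lemma subst_disjoint s f g : exists N s',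
  subst s' f = subst s f /\ subst s' (shift N g) = g.
Proof.
have [N [substN _]] := finite_support f.
exists N, (fun i => if (i < N)%N then s i else gen (i - N)); split.
  by apply: substN => i ->.
rewrite subst_shift -[RHS]subst_id; congr (subst _ _).
by apply: funext => i; rewrite ltnNge leq_addr addKn.
Qed.

(** To get $s(a) b \in J$, multiply $a$ by a shifted copy of $b$ and apply a single substitution to
    the product. *)
Lemma T_closed_colon I J :
  T_closed J -> T_closed I -> T_closed (ideal_colon J I).
Proof.
move=> [idJ TJ] [idI TI]; split; first exact: two_sided_ideal_colon.
move=> s a Ja b Ib; have [N [s' [<- <-]]] := subst_disjoint s a b.
by rewrite -substM; apply/TJ/Ja/TI.
Qed.

Lemma T_closed_colonr I J :
  T_closed J -> T_closed I -> T_closed (ideal_colonr J I).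
Proof.
move=> [idJ TJ] [idI TI]; split; first exact: two_sided_ideal_colonr.
move=> s b Jb a Ia; have [N [s' [<- <-]]] := subst_disjoint s b a.
by rewrite -substM; apply/TJ/Jb/TI.
Qed.

Lemma T_closed_mul_sub P Q V W : T_closed P -> T_closed Q ->
  T_closed V -> T_closed W ->
  ideal_mul P Q `<=` ideal_mul V W -> P `<=` V \/ Q `<=` W.
Proof.
move=> [idP TP] [idQ TQ] [idV TV] [idW TW] PQVW.
have [|/existsNP[f /not_implyP[Pf nVf]]] := pselect (P `<=` V); first by left.
right=> g Qg; have [p [pV Vp]] := ideal_projection _ idV.
(* If all coordinates of $p(f)$ vanished, then $f = f - p(f)$ would be in $V$. *)
have [w pfw] : exists w, (coord w (p f) : F) != 0.
  apply: contrapT => /forallNP pf0; apply: nVf; rewrite -[f]subr0.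
  have [S /(_ (undup S) (undup_uniq S))] := coord_span (p f).
  rewrite big1 => [<- //|w _]; first by move=> x; rewrite mem_undup.
  by have /negP/negPn/eqP -> := pf0 w; rewrite scale0r.
have [N [substN derN]] := finite_support f.
(* [nu] fixes $f$ and sends the variables of [shift N g] to 0. *)
pose nu i := if (i < N)%N then gen i else 0.
have nuf : subst nu f = f.
  by rewrite -[RHS]subst_id; apply: substN => i; rewrite /nu => ->.
have nug u : subst nu (shift N u) = subst (fun=> 0) u.
  rewrite subst_shift; congr (subst _ _); apply: funext => i.
  by rewrite /nu ltnNge leq_addr.
have VWfg : ideal_mul V W (f * shift N g).
  by apply/PQVW/ideal_mulP => //; exact: TQ.
(* [nu] maps $f$ times the shifted $g$ to $g(0) f \in V$, so $g(0) \neq 0$ would give $f \in V$. *)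
have eps0 : subst (fun=> 0) g = 0.
  have [c gc] := substZ1 g.
  rewrite gc; have [->|cN0] := eqVneq c 0; first by rewrite scale0r.
  case: nVf; rewrite -[f]scale1r -(mulVf cN0) -scalerA.
  apply: idealZ => //; rewrite -[f]mulr1 scaler_mulr -gc -nug -{1}nuf -substM.
  by apply/TV/(ideal_mul_subl V W).
pose eps u : F := coord [::] (subst (fun=> 0) u).
have epsE u : subst (fun=> 0) u = (eps u)%:A.
  have [c uc] := substZ1 u; rewrite /eps uc linearZ /coord /= linext1 eqxx.
  by congr (_ *: _); rewrite -[LHS]mulr1.
pose psi y : F := coord w (p (subst nu y)).
have psiL c x y : psi (c *: x + y) = c * psi x + psi y.
  by rewrite /psi !linearP.
have psiV x : V x -> psi x = 0.
  by move=> Vx; rewrite /psi pV ?linear0 //; exact: TV.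
(* [der j eps g] is the $g_j$ of $g = g(0) + \sum_j x_j g_j$, as [eps] kills nonempty prefixes. The
   letter $N + j$ does not occur in $f$, so [der (N + j) psi] of the product is the nonzero scalar
   [coord w (p f)] times the shifted $g_j$. *)
have Wder j : W (der j eps g).
  have := der_ideal_mul V W (N + j) psi _ idV idW psiL psiV VWfg.
  rewrite derM // derN ?leq_addr // mul0r add0r der_shift.
  have -> : (fun u => psi (f * u)) \o shift N =
      fun u => (coord w (p f) : F) * eps u.
    apply: funext => u; rewrite /psi /= substM nuf nug epsE -scaler_mulr mulr1.
    by rewrite !linearZ /= mulrC.
  rewrite der_scale linearZ => /(idealZ W (coord w (p f) : F)^-1 _ idW).
  rewrite scalerA mulVf // scale1r.
  move=> /(TW (fun i => gen (i - N))); rewrite subst_shift.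
  rewrite (_ : (fun i => _) = gen) ?subst_id //.
  by apply: funext => i; rewrite addKn.
have eps_gen u i : subst (fun=> 0) (u * gen i) = 0.
  by rewrite substM subst_gen mulr0.
(* For $p$ the constant term map and $g(0) = 0$, the expansion at $u = 1$ writes $g$ as a left
   combination of multiples of the $g_i$. *)
have [|N' [S /(_ N' (undup S) (leqnn N') (undup_uniq S))]] :=
    schreier_expansion (subst (fun=> 0)) _ g 1.
  by move=> u i; rewrite !eps_gen.
rewrite subst1 !mul1r eps0 subr0 => -> => [|v]; last by rewrite mem_undup.
apply: ideal_sum => // i _; apply: ideal_sum => // v _.
have [_ _ Wl _] := idW; apply: Wl.
rewrite (_ : (fun y => _) = fun u => (coord v 1 : F) * eps u).
  by rewrite der_scale; exact: idealZ.
by apply: funext => u; rewrite mul1r epsE linearZ /= mulrC.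
Qed.

(** Take $A = (W : Q)$ if $P \subseteq V$, and the mirror colon of $V$ by $P$ if $Q \subseteq W$. *)
Lemma T_closed_mul_dichotomy P Q V W : T_closed P -> T_closed Q ->
  T_closed V -> T_closed W -> ideal_mul P Q `<=` ideal_mul V W ->
  (exists A, [/\ T_closed A, P `<=` ideal_mul V A & ideal_mul A Q `<=` W]) \/
  (exists B, [/\ T_closed B, ideal_mul P B `<=` V & Q `<=` ideal_mul B W]).
Proof.
move=> TP TQ TV TW PQVW.
have [idP _] := TP; have [idQ _] := TQ; have [idV _] := TV; have [idW _] := TW.
have [PV|QW] := T_closed_mul_sub _ _ _ _ TP TQ TV TW PQVW; [left|right].
  exists (ideal_colon W Q); split; first exact: T_closed_colon.
    exact: ideal_mul_factorl.
  exact: ideal_mul_colon.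
exists (ideal_colonr V P); split; first exact: T_closed_colonr.
  by have [V0 VD _ _] := idV; apply: ideal_mul_sub => // a b Pa; apply.
exact: ideal_mul_factorr.
Qed.

Lemma T_closed_prod n (I_ : 'I_n -> set R) :
  (forall i, T_closed (I_ i)) -> T_closed (ideal_prod I_).
Proof.
elim: n I_ => [|n IHn] I_ TI; first by rewrite /ideal_prod big_ord0.
by rewrite ideal_prodS; apply: T_closed_mul => //; exact: IHn.
Qed.

Lemma T_closed_cons n I (I_ : 'I_n -> set R) : T_closed I ->
  (forall i, T_closed (I_ i)) -> forall i, T_closed (ideal_cons n I I_ i).
Proof.
move=> TI TI_ i; case: (unliftP ord0 i) => [j|] ->; last by rewrite ideal_cons0.
by rewrite ideal_consS.
Qed.

(** Each case of the dichotomy removes the first factor on one side and replaces the first factor on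
    the other side by $A$. If one side has a single factor, its product and the other family already
    form a refinement. *)
Lemma T_closed_refinement k l (V : 'I_k.+1 -> set R) (V' : 'I_l.+1 -> set R) :
  (forall i, T_closed (V i)) -> (forall j, T_closed (V' j)) ->
  ideal_prod V' `<=` ideal_prod V ->
  exists (I_ : 'I_k.+1 -> set R) (I'_ : 'I_l.+1 -> set R),
    [/\ forall i, T_closed (I_ i), forall j, T_closed (I'_ j),
        ideal_prod I_ = ideal_prod I'_,
        forall i, I_ i `<=` V i & forall j, V' j `<=` I'_ j].
Proof.
elim: k l V V' => [|k IHk] l V V' TV TV'.
  (* For $k = 1$ the common product is $V'$ itself. *)
  have TprodV' := T_closed_prod _ _ TV'.
  rewrite (@ideal_prod1 _ V) => [V'V|]; last by case: (TV ord0).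
  exists (fun=> ideal_prod V'), V'; split=> //.
  - by rewrite ideal_prod1 //; case: TprodV'.
  - by move=> i; rewrite ord1.
  - by move=> j x.
elim: l V V' TV TV' => [|l IHl] V V' TV TV'.
  have TprodV := T_closed_prod _ _ TV.
  rewrite (@ideal_prod1 _ V') => [V'V|]; last by case: (TV' ord0).
  exists V, (fun=> ideal_prod V); split=> //.
  - by rewrite ideal_prod1 //; case: TprodV.
  - by move=> i x.
  - by move=> j; rewrite ord1.
rewrite (ideal_prodS V) (ideal_prodS V') => V'V.
have TV1 i : T_closed (V (lift ord0 i)) by [].
have TV'1 j : T_closed (V' (lift ord0 j)) by [].
have [[A [TA V'VA AV'V]]|[A [TA V'AV V'AV']]] := T_closed_mul_dichotomy _ _ _ _
    (TV' ord0) (T_closed_prod _ _ TV'1) (TV ord0) (T_closed_prod _ _ TV1) V'V.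
  rewrite -ideal_prod_cons in AV'V.
  have [I_ [I'_ [TI TI' II' IV VI']]] :=
    IHk _ _ _ TV1 (T_closed_cons _ _ _ TA TV'1) AV'V.
  (* The factor $V_1$ is put back on both sides, absorbed on the right by $I'_1 \supseteq A$: thus
     $V'_1 \subseteq V_1 A \subseteq V_1 I'_1$. *)
  exists (ideal_cons _ (V ord0) I_),
    (ideal_cons _ (ideal_mul (V ord0) (I'_ ord0)) (fun j => I'_ (lift ord0 j))).
  split.
  - exact: T_closed_cons.
  - by apply: T_closed_cons => //; exact: T_closed_mul.
  - by rewrite !ideal_prod_cons II' ideal_prodS ideal_mulA.
  - move=> i; case: (unliftP ord0 i) => [j|] ->.
      by rewrite ideal_consS; exact: IV.
    by rewrite ideal_cons0.
  - move=> i; case: (unliftP ord0 i) => [j|] ->; last first.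
      rewrite ideal_cons0; apply: subset_trans V'VA _.
      by apply: ideal_mul_subset => //; have := VI' ord0; rewrite ideal_cons0.
    by have := VI' (lift ord0 j); rewrite !ideal_consS.
rewrite -ideal_prod_cons in V'AV'.
have [I_ [I'_ [TI TI' II' IV VI']]] :=
  IHl _ _ (T_closed_cons _ _ _ TA TV1) TV'1 V'AV'.
(* Symmetrically, $V'_1$ is absorbed by $I_1 \subseteq A$: thus $V'_1 I_1 \subseteq V'_1 A \subseteq
   V_1$. *)
exists
  (ideal_cons _ (ideal_mul (V' ord0) (I_ ord0)) (fun j => I_ (lift ord0 j))),
  (ideal_cons _ (V' ord0) I'_).
split.
- by apply: T_closed_cons => //; exact: T_closed_mul.
- exact: T_closed_cons.
- by rewrite !ideal_prod_cons -II' (ideal_prodS I_) ideal_mulA.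
- move=> i; case: (unliftP ord0 i) => [j|] ->; last first.
    rewrite ideal_cons0; apply: subset_trans V'AV.
    by apply: ideal_mul_subset => //; have := IV ord0; rewrite ideal_cons0.
  by have := IV (lift ord0 j); rewrite !ideal_consS.
- move=> i; case: (unliftP ord0 i) => [j|] ->.
    by rewrite ideal_consS; exact: VI'.
  by rewrite ideal_cons0.
Qed.

End Ideals.

End FreeAlgebra.

(** * The monoid algebra of words as an instance of [word_basis] *)

Section MonoidAlgebra.
Context {K : monomType} {F : comNzRingType}.

Lemma mkmalgU_scale c (k : K) : << c *g k >> = c *: << k >> :> {malg F[K]}.
Proof. by apply/malgP => k'; rewrite mcoeffZ !mcoeffU mulrnAr mulr1. Qed.

(* [monalg] only gives a left algebra when the monoid is not commutative. *)
Lemma malg_scalerAr c (f g : {malg F[K]}) : c *: (f * g) = f * (c *: g).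
Proof.
have fsub := fsubset_refl.
rewrite (malgMEw (fsub _ _) (msuppZ_le c g)) (malgMEw (fsub _ _) (fsub _ _)).
rewrite scaler_sumr; apply: eq_bigr => u _.
rewrite scaler_sumr; apply: eq_bigr => v _.
by apply/malgP => w; rewrite !(mcoeffZ, mcoeffU) mulrCA mulrnAr.
Qed.

End MonoidAlgebra.

Section FreeAlgebraBasis.
Context {F : fieldType}.
Local Notation R := (freeAlg F).
Implicit Types f g : R.

Let mword (w : seq nat) : R := << FMonom w >>.

Let mword_nil : mword [::] = 1.
Proof. by rewrite /mword -fmoneE. Qed.

Let mword_cat w w' : mword (w ++ w') = mword w * mword w'.
Proof. by rewrite malgM_def fgmulUU mulr1 /mword /mmul /= fmmulE. Qed.

Let mword_ind (P : R -> Prop) : (forall w, P (mword w)) ->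
  (forall c f g, P f -> P g -> P (c *: f + g)) -> forall f, P f.
Proof.
move=> Pw PD f; rewrite [f]monalgE.
apply: (big_rec P) => [|[m] g _ Pg].
  (* The empty sum is reached as $-w + w$, since [P 0] is not among the hypotheses. *)
  by rewrite -(subrr (mword [::])) -scaleN1r addrC; exact: PD.
by rewrite mkmalgU_scale; apply: PD => //; exact: Pw.
Qed.

Section Linext.
Context (M : lmodType F) (b : seq nat -> M).

Let lin f : M := \sum_(w <- msupp f) f@_w *: b w.

Let linE (d : {fset {fmonom nat}}) f : (msupp f `<=` d)%fset ->
  lin f = \sum_(w <- d) f@_w *: b w.
Proof.
move=> fd; rewrite /lin (big_fset_incl _ fd) // => w _ /mcoeff_outdom ->.
by rewrite scale0r.
Qed.

Let lin_is_linear : linear lin.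
Proof.
move=> c f g; pose d := (msupp f `|` msupp g)%fset.
rewrite (@linE d f) ?fsubsetUl // (@linE d g) ?fsubsetUr // (@linE d).
  rewrite scaler_sumr -big_split; apply: eq_bigr => w _ /=.
  by rewrite mcoeffD mcoeffZ scalerDl scalerA.
apply: fsubset_trans (msuppD_le _ _) _.
by apply: fsetSU; apply: msuppZ_le.
Qed.

Definition malg_linext : {linear R -> M} :=
  HB.pack_for {linear R -> M} lin
    (GRing.isLinear.Build F R M _ lin lin_is_linear).

Lemma malg_linext_word w : malg_linext (mword w) = b w.
Proof. by rewrite /= /lin msuppU1 big_seq_fset1 mcoeffUU scale1r. Qed.

End Linext.

Definition freeAlg_basis : word_basis F R :=
  WordBasis _ _ mword malg_linext mword_nil mword_cat malg_linext_word
    mword_ind malg_scalerAr.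

Lemma T_idealE : @T_ideal F = T_closed freeAlg_basis.
Proof. by apply: funext => I; apply/propext/T_closedP. Qed.

End FreeAlgebraBasis.

Theorem theorem1p1 (F : fieldType) (k l : nat) (hk : (1 <= k)%N) (hl : (1 <= l)%N)
    (V : 'I_k -> set (freeAlg F)) (V' : 'I_l -> set (freeAlg F))
    (hV : forall i, T_ideal (V i)) (hV' : forall j, T_ideal (V' j)) :
  ideal_prod V' `<=` ideal_prod V <->
  exists (I : set (freeAlg F)) (I_ : 'I_k -> set (freeAlg F))
         (I'_ : 'I_l -> set (freeAlg F)),
    [/\ T_ideal I, forall i, T_ideal (I_ i) & forall j, T_ideal (I'_ j)] /\
    [/\ I = ideal_prod I_, I = ideal_prod I'_,
        forall i, I_ i `<=` V i & forall j, V' j `<=` I'_ j].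
Proof.
split; last first.
  (* Products are monotone, so $V' \subseteq I'_1 \cdots I'_l = I_1 \cdots I_k \subseteq V$. *)
  move=> [I [I_ [I'_ [_ [-> II' IV V'I']]]]].
  apply: subset_trans (ideal_prod_subset _ _ _ IV); rewrite II'.
  exact: ideal_prod_subset.
case: k hk V hV => // k _ V; case: l hl V' hV' => // l _ V'.
rewrite !T_idealE => TV' TV.
move=> /(T_closed_refinement _ _ _ _ _ TV TV') [I_ [I'_ [TI TI' II' IV V'I']]].
exists (ideal_prod I_), I_, I'_; split; split=> //.
exact: T_closed_prod.
Qed.
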